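(* Let $K$ be a field, $S=K[t_1,\ldots,t_s]$, let $I\subset S$ be a nonzero proper monomial ideal, and let $I=\mathfrak{q}_1\cap\cdots\cap\mathfrak{q}_r$ be its canonical minimal primary decomposition (defined in the context). Let $w$ be a standard linear weighting of $S$ and let $n\geq 1$ be a fixed integer. Then $I^n=\bigcap_{i=1}^r\mathfrak{q}_i^n$ if and only if $(I_w)^n=\bigcap_{i=1}^r((\mathfrak{q}_i)_w)^n$.
   Context: For $a=(a_1,\ldots,a_s)\in\mathbb{N}^s$ (with $\mathbb{N}=\{0,1,\ldots\}$) write $t^a=t_1^{a_1}\cdots t_s^{a_s}$. A monomial ideal is an ideal generated by a finite set of monomials. Standard linear weighting: a linear map $w\colon\mathbb{R}^s\to\mathbb{R}^s$ of the form $w(a)=(d_1a_1,\ldots,d_sa_s)$ for some positive integers $d_1,\ldots,d_s$. For a monomial ideal $I$, the weighted monomial ideal is $I_w:=(\{t^{w(a)}\mid t^a\in I\})$. Canonical minimal primary decomposition: a nonzero proper monomial ideal $I$ has a unique irreducible decomposition $I=I_1\cap\cdots\cap I_m$, where each $I_i$ is of the form $(\{t_k^{b_k}\mid b_k\geq 1\})$ for some $b=(b_1,\ldots,b_s)\in\mathbb{N}^s\setminus\{0\}$, and $I\neq\bigcap_{i\neq j}I_i$ for all $j$. Let $\{\mathfrak{p}_1,\ldots,\mathfrak{p}_r\}$ be the set of distinct radicals $\mathrm{rad}(I_j)$, $1\le j\le m$, and put $\mathfrak{q}_i:=\bigcap_{\mathrm{rad}(I_j)=\mathfrak{p}_i}I_j$.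 Then $I=\mathfrak{q}_1\cap\cdots\cap\mathfrak{q}_r$ is a minimal primary decomposition of $I$, with $\mathfrak{q}_i$ a $\mathfrak{p}_i$-primary monomial ideal. *)

(* Defs.v *)
From mathcomp Require Import all_boot all_order all_algebra.
From mathcomp Require Import boolp classical_sets.
From mathcomp Require Export mpoly.

Set Implicit Arguments.
Unset Strict Implicit.
Unset Printing Implicit Defensive.

Import GRing.Theory.

Local Open Scope ring_scope.
Local Open Scope classical_set_scope.

(* Ideals are represented by their sets of elements, so that equality of ideals
   is equality of sets. *)

Section Ideals.
Variable R : comNzRingType.
Implicit Types (A I J : set R).

Definition ideal_gen A : set R :=
  [set f | exists (k : nat) (c g : 'I_k -> R),
     (forall i, A (g i)) /\ f = \sum_(i < k) c i * g i].

Definition ideal_mul I J : set R :=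
  ideal_gen [set f | exists g h, [/\ I g, J h & f = g * h]].

Fixpoint ideal_exp I (n : nat) : set R :=
  if n is n'.+1 then ideal_mul I (ideal_exp I n') else [set: R].

Definition radical I : set R := [set f | exists k : nat, I (f ^+ k)].

End Ideals.

Section MonomialIdeals.
Variables (K : fieldType) (s : nat).
Implicit Types (I : set {mpoly K[s]}).

Definition monomial_ideal I : Prop :=
  exists A : seq 'X_{1..s},
    I = ideal_gen [set f | exists2 a, a \in A & f = 'X_[a]].

Definition irreducible_monomial_ideal I : Prop :=
  exists2 b : 'X_{1..s}, b <> 0%MM &
    I = ideal_gen [set f | exists2 k : 'I_s, (1 <= b k)%N & f = 'X_k ^+ b k].

Definition irreducible_decomposition I (m : nat)
    (J : 'I_m -> set {mpoly K[s]}) : Prop :=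
  [/\ forall i, irreducible_monomial_ideal (J i),
      I = \bigcap_i J i
    & forall j, I <> \bigcap_(i in [set i | i != j]) J i].

(* The irreducible decomposition of a nonzero proper monomial ideal is unique up
   to the order of its components, hence q is determined by I up to reindexing. *)
Definition canonical_primary_decomposition I (r : nat)
    (q : 'I_r -> set {mpoly K[s]}) : Prop :=
  exists (m : nat) (J : 'I_m -> set {mpoly K[s]})
         (p : 'I_r -> set {mpoly K[s]}),
    [/\ irreducible_decomposition I J,
        injective p,
        range p = range (fun j => radical (J j))
      & forall i, q i = \bigcap_(j in [set j | radical (J j) = p i]) J j].

(* A standard linear weighting only ever acts on exponent vectors, so it is
   given by its restriction to N^s. *)
Definition standard_linear_weighting (w : 'X_{1..s} -> 'X_{1..s}) : Prop :=
  exists2 d : 'I_s -> nat, (forall i, 0 < d i)%N &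
    forall (a : 'X_{1..s}) i, w a i = (d i * a i)%N.

Definition weighted_ideal (w : 'X_{1..s} -> 'X_{1..s}) I : set {mpoly K[s]} :=
  ideal_gen [set f | exists2 a : 'X_{1..s}, I 'X_[a] & f = 'X_[w a]].

End MonomialIdeals.

(* Main.v *)
Require Import Defs.
From mathcomp Require Import all_boot all_order all_algebra.
From mathcomp Require Import boolp classical_sets.

(** The theorem is a statement about exponent vectors.  A monomial ideal is the
    span of the monomials whose exponents lie in an upward closed set of N^s
    ([monomial_span]); intersections of ideals become intersections of such
    sets ([bigcap_monomial_span]) and powers of ideals become iterated
    Minkowski sums ([ideal_exp_monomial_span]).

    Let w multiply the k-th coordinate by d_k, and let phi divide the k-th
    coordinate by d_k, rounding down.  Since w a <= b exactly when a <= phi b,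
    weighting an ideal replaces its exponent set U by the preimage of U under
    phi ([weighted_ideal_monomial_span]).  Taking preimages commutes with
    intersections, and here also with Minkowski sums of upward closed sets
    ([preimage_mnm_div_sum]): phi is superadditive, and a decomposition
    phi c = u + v lifts to c = w u + (c - w u).  So the right-hand equality of
    ideals says that two exponent sets have the same preimage under phi, while
    the left-hand one says that they are equal.  The two are equivalent because
    phi is surjective, w being a section of it. *)

Set Implicit Arguments.
Unset Strict Implicit.
Unset Printing Implicit Defensive.

Import GRing.Theory.

Local Open Scope ring_scope.
Local Open Scope classical_set_scope.

(** * Upward closed sets of exponents *)

Section ExponentSets.
Variable s : nat.
Implicit Types (U V : set 'X_{1..s}) (a b c u v : 'X_{1..s}).

Definition upward_closed U : Prop := forall a b, U a -> U (a + b)%MM.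

Definition minkowski_sum U V : set 'X_{1..s} :=
  [set c | exists u v, [/\ U u, V v & c = (u + v)%MM]].

(** The neutral element is the whole of N^s rather than {0}, because it has to
    be the exponent set of the unit ideal. *)
Fixpoint minkowski_multiple U (n : nat) : set 'X_{1..s} :=
  if n is n'.+1 then minkowski_sum U (minkowski_multiple U n') else setT.

Lemma upward_closed_le U a b : upward_closed U -> U a -> (a <= b)%MM -> U b.
Proof. by move=> Uup Ua /submK <-; rewrite addmC; apply: Uup. Qed.

Lemma upward_closed_sum U V : upward_closed V -> upward_closed (minkowski_sum U V).
Proof.
move=> Vup _ b [u [v [Uu Vv ->]]]; exists u, (v + b)%MM.
by split=> //; [exact: Vup | rewrite addmA].
Qed.

Lemma upward_closed_multiple U n : upward_closed (minkowski_multiple U n).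
Proof. by elim: n => [|n IHn] //; apply: upward_closed_sum. Qed.

Lemma upward_closed_bigcap (T : Type) (P : set T) (F : T -> set 'X_{1..s}) :
  (forall i, P i -> upward_closed (F i)) -> upward_closed (\bigcap_(i in P) F i).
Proof. by move=> Fup a b Fa i Pi; apply: (Fup i Pi); apply: Fa. Qed.

Definition mnm_div (d : 'I_s -> nat) b : 'X_{1..s} :=
  [multinom (b i %/ d i)%N | i < s].

Section Weighting.
Variables (d : 'I_s -> nat) (w : 'X_{1..s} -> 'X_{1..s}).
Hypothesis d_gt0 : forall i, (0 < d i)%N.
Hypothesis wE : forall a i, w a i = (d i * a i)%N.

Lemma weightingK : cancel w (mnm_div d).
Proof. by move=> a; apply/mnmP => i; rewrite mnmE wE mulKn. Qed.

(** A Galois connection: [mnm_div d b] is the largest exponent whose weighting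
    is below [b]. *)
Lemma weighting_le_mnm_div a b : (w a <= b)%MM = (a <= mnm_div d b)%MM.
Proof.
by apply/mnm_lepP/mnm_lepP => le_ab i; move: (le_ab i);
  rewrite mnmE wE leq_divRL // mulnC.
Qed.

Lemma mnm_div_sub_weighting u c : mnm_div d (c - w u)%MM = (mnm_div d c - u)%MM.
Proof. by apply/mnmP => i; rewrite !mnmE wE mulnC divnBMl. Qed.

Lemma mnm_div_superadditive a b :
  (mnm_div d a + mnm_div d b <= mnm_div d (a + b)%MM)%MM.
Proof. by apply/mnm_lepP => i; rewrite !mnmE leq_divRL // mulnDl leq_add // leq_trunc_div. Qed.

(** Upward closedness is what absorbs the defect of additivity of rounding down:
    [mnm_div d a + mnm_div d b] may be strictly below [mnm_div d (a + b)]. *)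
Lemma preimage_mnm_div_sum U V : upward_closed V ->
  minkowski_sum (mnm_div d @^-1` U) (mnm_div d @^-1` V)
    = mnm_div d @^-1` minkowski_sum U V.
Proof.
move=> Vup; apply/seteqP; split=> [_ [a [b [Ua Vb ->]]] | c [u [v [Uu Vv def_c]]]] /=.
  rewrite -(submK (mnm_div_superadditive a b)) addmC.
  by apply: upward_closed_sum => //; exists (mnm_div d a), (mnm_div d b).
(* All the remainders of the division are left to the second summand. *)
exists (w u), (c - w u)%MM; split=> /=; first by rewrite weightingK.
  by rewrite mnm_div_sub_weighting def_c addmC addmK.
by rewrite addmC submK // weighting_le_mnm_div def_c lem_addr.
Qed.

Lemma preimage_mnm_div_multiple U n :
  minkowski_multiple (mnm_div d @^-1` U) n
    = mnm_div d @^-1` minkowski_multiple U n.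
Proof.
elim: n => [|n IHn] //=.
by rewrite IHn preimage_mnm_div_sum //; apply: upward_closed_multiple.
Qed.

Lemma preimage_mnm_div_inj : injective (preimage (mnm_div d)).
Proof.
move=> U V eqUV; apply/funext => a.
by have := congr1 (@^~ (w a)) eqUV; rewrite /preimage /= weightingK.
Qed.

End Weighting.
End ExponentSets.

(** * Ideals spanned by monomials *)

Section MonomialSpans.
Variables (K : fieldType) (s : nat).
Implicit Types (U V : set 'X_{1..s}) (f g : {mpoly K[s]}).

Definition monomial_span U : set {mpoly K[s]} :=
  [set f | forall a, a \in msupp f -> U a].

Lemma monomial_spanX U a : monomial_span U 'X_[a] <-> U a.
Proof.
split=> [|Ua b]; first by apply; rewrite msuppX mem_seq1.
by rewrite msuppX mem_seq1 => /eqP ->.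
Qed.

Lemma monomial_span_inj : injective monomial_span.
Proof.
move=> U V eqUV; apply/seteqP.
by split=> a /monomial_spanX; rewrite (eqUV, =^~ eqUV) => /monomial_spanX.
Qed.

Lemma bigcap_monomial_span (T : Type) (P : set T) (F : T -> set 'X_{1..s}) :
  \bigcap_(i in P) monomial_span (F i) = monomial_span (\bigcap_(i in P) F i).
Proof.
apply/seteqP; split=> f Ff; first by move=> a fa i Pi; apply: (Ff i Pi).
by move=> i Pi a fa; apply: Ff.
Qed.

Lemma monomial_spanM U V f g :
  monomial_span U f -> monomial_span V g ->
  monomial_span (minkowski_sum U V) (f * g).
Proof.
move=> Uf Vg a /msuppM_le /allpairsP [[u v] /= [fu gv ->]].
by exists u, v; split=> //; [apply: Uf | apply: Vg].
Qed.

(** A polynomial in the span is the sum of its terms, so that only its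
    monomials have to be reached by the generators. *)
Lemma ideal_gen_monomial_span U (G : set {mpoly K[s]}) :
    upward_closed U -> G `<=` monomial_span U ->
    (forall u, U u -> exists c g, G g /\ 'X_[u] = c * g) ->
  ideal_gen G = monomial_span U.
Proof.
move=> Uup GU genU; apply/seteqP; split=> [_ [k [c [g [Gg ->]]]] a | f Uf].
  move=> /msupp_sum_le /flattenP [_ /mapP [i _ ->]].
  (* An arbitrary coefficient lies in the span of all of N^s. *)
  move=> /(monomial_spanM (U := setT) (fun _ _ => Logic.I) (GU _ (Gg i))).
  by move=> [b [u [_ Uu ->]]]; rewrite addmC; apply: Uup.
have term (i : 'I_(size (msupp f))) : exists cg : {mpoly K[s]} * {mpoly K[s]},
    G cg.2 /\ 'X_[tnth (in_tuple (msupp f)) i] = cg.1 * cg.2.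
  have [|c [g [Gg def_g]]] := genU (tnth (in_tuple (msupp f)) i).
    by apply: Uf; apply: mem_tnth.
  by exists (c, g).
have [cg cgP] := choice term.
exists (size (msupp f)),
  (fun i => f@_(tnth (in_tuple (msupp f)) i) *: (cg i).1), (fun i => (cg i).2).
split=> [i|]; first by have [] := cgP i.
rewrite {1}[f]mpolyE big_tnth; apply: eq_bigr => i _.
by have [_ ->] := cgP i; rewrite scalerAl.
Qed.

Lemma ideal_gen_monomials (A : set 'X_{1..s}) :
  ideal_gen [set f | exists2 a, A a & f = 'X_[a]]
    = monomial_span (minkowski_sum A setT).
Proof.
apply: ideal_gen_monomial_span; first exact: upward_closed_sum.
  move=> _ [a Aa ->]; apply/monomial_spanX.
  by exists a, 0%MM; rewrite addm0.
move=> _ [a [b [Aa _ ->]]]; exists 'X_[b], 'X_[a].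
by split; [exists a | rewrite mulrC mpolyXD].
Qed.

Lemma ideal_mul_monomial_span U V : upward_closed V ->
  ideal_mul (monomial_span U) (monomial_span V)
    = monomial_span (minkowski_sum U V).
Proof.
move=> Vup; apply: ideal_gen_monomial_span; first exact: upward_closed_sum.
  by move=> _ [g [h [Ug Vh ->]]]; apply: monomial_spanM.
move=> _ [u [v [Uu Vv ->]]]; exists 1, ('X_[u] * 'X_[v]).
split; last by rewrite mul1r mpolyXD.
by exists 'X_[u], 'X_[v]; split=> //; apply/monomial_spanX.
Qed.

Lemma ideal_exp_monomial_span U n :
  ideal_exp (monomial_span U) n = monomial_span (minkowski_multiple U n).
Proof.
elim: n => [|n IHn] /=; first by apply/seteqP.
by rewrite IHn ideal_mul_monomial_span //; apply: upward_closed_multiple.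
Qed.

(** An exponent [b] is above [w a] for some [a] in [U] exactly when
    [mnm_div d b] is above such an [a], that is, when it lies in [U]. *)
Lemma weighted_ideal_monomial_span d (w : 'X_{1..s} -> 'X_{1..s}) U :
    (forall i, 0 < d i)%N -> (forall a i, w a i = (d i * a i)%N) ->
    upward_closed U ->
  weighted_ideal w (monomial_span U) = monomial_span (mnm_div d @^-1` U).
Proof.
move=> d_gt0 wE Uup; apply: ideal_gen_monomial_span => [a b Ua||b Ub] /=.
- apply: (upward_closed_le Uup Ua).
  exact: lepm_trans (lem_addr _ _) (mnm_div_superadditive d_gt0 a b).
- move=> _ [a /monomial_spanX Ua ->]; apply/monomial_spanX => /=.
  by rewrite (weightingK d_gt0 wE).
exists 'X_[b - w (mnm_div d b)], 'X_[w (mnm_div d b)]; split.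
  by exists (mnm_div d b) => //; apply/monomial_spanX.
by rewrite -mpolyXD submK // (weighting_le_mnm_div d_gt0 wE) lepm_refl.
Qed.

(** Allowing infinitely many generators makes this property pass to
    intersections without an appeal to Dickson's lemma. *)
Definition spanned_by_monomials (J : set {mpoly K[s]}) : Prop :=
  exists2 U, upward_closed U & J = monomial_span U.

Lemma spanned_by_monomials_bigcap (T : Type) (P : set T)
    (F : T -> set {mpoly K[s]}) :
  (forall i, spanned_by_monomials (F i)) ->
  spanned_by_monomials (\bigcap_(i in P) F i).
Proof.
move=> FP; have /choice [U UP] i :
    exists V, upward_closed V /\ F i = monomial_span V.
  by have [V ? ?] := FP i; exists V.
exists (\bigcap_(i in P) U i).
  by apply: upward_closed_bigcap => i _; have [] := UP i.
by rewrite -bigcap_monomial_span; apply: eq_bigcapr => i _; have [] := UP i.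
Qed.

Lemma spanned_by_monomials_gen (A : set 'X_{1..s}) :
  spanned_by_monomials (ideal_gen [set f | exists2 a, A a & f = 'X_[a]]).
Proof.
exists (minkowski_sum A setT); first exact: upward_closed_sum.
exact: ideal_gen_monomials.
Qed.

Lemma irreducible_spanned_by_monomials J :
  irreducible_monomial_ideal J -> spanned_by_monomials J.
Proof.
move=> [b _ ->].
have -> : [set f : {mpoly K[s]} | exists2 k, (1 <= b k)%N & f = 'X_k ^+ b k]
    = [set f | exists2 a, [set a | exists2 k, (1 <= b k)%N
                                 & a = (U_(k) *+ b k)%MM] a & f = 'X_[a]].
  apply/seteqP; split=> [_ [k bk ->] | _ [_ [k bk ->] ->]] /=.
    by exists (U_(k) *+ b k)%MM; [exists k | apply: mpolyXn].
  by exists k; rewrite ?mpolyXn.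
exact: spanned_by_monomials_gen.
Qed.

Lemma canonical_spanned_by_monomials I r (q : 'I_r -> set {mpoly K[s]}) i :
  canonical_primary_decomposition I q -> spanned_by_monomials (q i).
Proof.
move=> [m [J [p [[Jirr _ _] _ _ ->]]]].
by apply: spanned_by_monomials_bigcap => j; apply: irreducible_spanned_by_monomials.
Qed.

End MonomialSpans.

(** * Weightings and powers of the primary components *)

Theorem theorem4p5 (K : fieldType) (s : nat) (I : set {mpoly K[s]})
    (r : nat) (q : 'I_r -> set {mpoly K[s]})
    (w : 'X_{1..s} -> 'X_{1..s}) (n : nat) :
  monomial_ideal I -> I <> [set 0] -> I <> [set: {mpoly K[s]}] ->
  canonical_primary_decomposition I q ->
  standard_linear_weighting w ->
  (1 <= n)%N ->
  (ideal_exp I n = \bigcap_i ideal_exp (q i) n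
   <->
   ideal_exp (weighted_ideal w I) n
     = \bigcap_i ideal_exp (weighted_ideal w (q i)) n).
Proof.
move=> [A defI] _ _ qP [d d_gt0 wE] _.
have [U Uup ->] : spanned_by_monomials I.
  by rewrite defI; apply: (spanned_by_monomials_gen _ [set a | a \in A]).
have /choice [V VP] i : exists V, upward_closed V /\ q i = monomial_span V.
  by have [V ? ?] := canonical_spanned_by_monomials i qP; exists V.
have -> : \bigcap_i ideal_exp (q i) n
    = monomial_span (\bigcap_i minkowski_multiple (V i) n).
  rewrite -bigcap_monomial_span; apply: eq_bigcapr => i _.
  by have [_ ->] := VP i; rewrite ideal_exp_monomial_span.
have -> : \bigcap_i ideal_exp (weighted_ideal w (q i)) n
    = monomial_span (mnm_div d @^-1` \bigcap_i minkowski_multiple (V i) n).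
  rewrite preimage_bigcap -bigcap_monomial_span; apply: eq_bigcapr => i _.
  have [Vup ->] := VP i.
  by rewrite (weighted_ideal_monomial_span _ d_gt0 wE Vup)
    ideal_exp_monomial_span (preimage_mnm_div_multiple d_gt0 wE).
rewrite (weighted_ideal_monomial_span _ d_gt0 wE Uup) !ideal_exp_monomial_span.
rewrite (preimage_mnm_div_multiple d_gt0 wE).
split=> [/monomial_span_inj -> // | /monomial_span_inj].
by move=> /(preimage_mnm_div_inj d_gt0 wE) ->.
Qed.
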